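(* For all $\alpha,\beta\in\mathcal{F}_{\neg}$ the following are equivalent: (1) $\alpha\vdash_{\mathcal{L}_{DS}}\beta$; (2) $\alpha\vdash\beta$ is valid in the class of all dual Stone algebras; (3) $\alpha\vdash\beta$ is valid in the class of all dual Stone algebras $B^{[2]}$, $B$ ranging over all Boolean algebras; (4) $\alpha\vdash\beta$ is valid in the class of all dual Stone algebras $(\mathcal{P}(U))^{[2]}$, $U$ ranging over all sets.
   Context: Dual Stone algebras: algebras $(D,\vee,\wedge,\neg,0,1)$ with $(D,\vee,\wedge,0,1)$ a bounded distributive lattice, $\neg a=\min\{c\in D: a\vee c=1\}$ existing for every $a\in D$, and $\neg a\wedge\neg\neg a=0$ for all $a$. For a Boolean algebra $B$ with complement $^{c}$, $B^{[2]}:=\{(a,b)\in B^2:a\le b\}$ with componentwise $\vee,\wedge$, $0=(0,0)$, $1=(1,1)$ and $\neg(a,b):=(a^{c},a^{c})$; this is a dual Stone algebra. $(\mathcal{P}(U))^{[2]}$ is the case $B=\mathcal{P}(U)$. Formulas $\mathcal{F}_{\neg}$: built from propositional variables $p,q,r,\ldots$ and constants $\top,\bot$ with binary connectives $\vee,\wedge$ and unary connective $\neg$. A consequent is an expression $\alpha\vdash\beta$ with $\alpha,\beta$ formulas. The logic $\mathcal{L}_{DS}$: $\vdash_{\mathcal{L}_{DS}}$ is the least relation on $\mathcal{F}_{\neg}$ satisfying the following postulates and rules (premises / conclusion), for all formulas. BDLL: $\alpha\vdash\alpha$; $\alpha\vdash\beta,\ \beta\vdash\gamma\,/\,\alpha\vdash\gamma$;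 $\alpha\wedge\beta\vdash\alpha$, $\alpha\wedge\beta\vdash\beta$; $\alpha\vdash\beta,\ \alpha\vdash\gamma\,/\,\alpha\vdash\beta\wedge\gamma$; $\alpha\vdash\alpha\vee\beta$, $\beta\vdash\alpha\vee\beta$; $\alpha\vdash\gamma,\ \beta\vdash\gamma\,/\,\alpha\vee\beta\vdash\gamma$; $\alpha\wedge(\beta\vee\gamma)\vdash(\alpha\wedge\beta)\vee(\alpha\wedge\gamma)$; $\alpha\vdash\top$; $\bot\vdash\alpha$. Additional: $\alpha\vdash\beta\,/\,\neg\beta\vdash\neg\alpha$; $\neg(\alpha\wedge\beta)\vdash\neg\alpha\vee\neg\beta$; $\neg\top\vdash\bot$; $\gamma\vdash\alpha\vee\beta\,/\,\neg\beta\vdash\alpha\vee\neg\gamma$; $\top\vdash\alpha\vee\neg\alpha$; $\neg\alpha\wedge\neg\neg\alpha\vdash\bot$. A valuation in an algebra $A$ is a map $v$ from formulas to $A$ preserving $\vee,\wedge,\neg$ with $v(\bot)=0$, $v(\top)=1$. The consequent $\alpha\vdash\beta$ is valid in $A$ if $v(\alpha)\le v(\beta)$ for all valuations $v$ in $A$, and valid in a class of algebras if it is valid in each member. *)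

(* Defs.v *)
From HB Require Import structures.
From mathcomp Require Import all_boot all_order.

Set Implicit Arguments.
Unset Strict Implicit.
Unset Printing Implicit Defensive.

Import Order.Theory.
Local Open Scope order_scope.

(* No axiom [\bot != \top]: the one-element algebra is allowed. *)
HB.mixin Record TBDistrLattice_isDualStone d D of Order.TBDistrLattice d D := {
  dneg : D -> D;
  joinx_dneg : forall a : D, a `|` dneg a = \top;
  dneg_min : forall a c : D, a `|` c = \top -> dneg a <= c;
  dneg_stone : forall a : D, dneg a `&` dneg (dneg a) = \bot
}.

#[short(type="dualStoneType")]
HB.structure Definition DualStone d :=
  { D of Order.TBDistrLattice d D & TBDistrLattice_isDualStone d D }.

Section IncrPair.
Context (d : Order.disp_t) (B : ctbDistrLatticeType d).

(* [B *p B] carries the componentwise order, not the lexicographic one. *)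
Definition incr_pair_pred : pred (B *p B) := fun x => x.1 <= x.2.

(* The algebra $B^{[2]}$, a sublattice of [B *p B]. *)
Record incr_pair := IncrPair { incr_pair_val : B *p B; _ : incr_pair_pred incr_pair_val }.

HB.instance Definition _ := [isSub for incr_pair_val].
HB.instance Definition _ := [Choice of incr_pair by <:].

Fact incr_pair_meet_closed : meet_closed incr_pair_pred.
Proof. by move=> x y; rewrite !unfold_in /incr_pair_pred; apply: leI2. Qed.

Fact incr_pair_join_closed : join_closed incr_pair_pred.
Proof. by move=> x y; rewrite !unfold_in /incr_pair_pred; apply: leU2. Qed.

Fact incr_pair_bot : \bot \in incr_pair_pred.
Proof. by rewrite unfold_in /incr_pair_pred. Qed.

Fact incr_pair_top : \top \in incr_pair_pred.
Proof. by rewrite unfold_in /incr_pair_pred. Qed.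

HB.instance Definition _ :=
  Order.SubChoice_isTBSubLattice.Build _ (B *p B) incr_pair_pred
    (Order.prod_display d d) incr_pair
    incr_pair_meet_closed incr_pair_join_closed incr_pair_bot incr_pair_top.

Fact incr_pair_valI (x y : incr_pair) : val (x `&` y) = val x `&` val y.
Proof. exact: Order.valI_subproof. Qed.

Fact incr_pair_valU (x y : incr_pair) : val (x `|` y) = val x `|` val y.
Proof. exact: Order.valU_subproof. Qed.

Fact incr_pair_val0 : val (\bot : incr_pair) = \bot.
Proof. exact: Order.val0_subproof. Qed.

Fact incr_pair_val1 : val (\top : incr_pair) = \top.
Proof. exact: Order.val1_subproof. Qed.

Fact incr_pair_meetUl :
  @left_distributive incr_pair incr_pair Order.meet Order.join.
Proof.
by move=> x y z; apply: val_inj; rewrite !(incr_pair_valI, incr_pair_valU) meetUl.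
Qed.

HB.instance Definition _ :=
  Order.Lattice_Meet_isDistrLattice.Build (Order.prod_display d d) incr_pair
    incr_pair_meetUl.

Definition incr_pair_neg (x : incr_pair) : incr_pair :=
  @IncrPair (~` (val x).1, ~` (val x).1) (lexx (~` (val x).1)).

Fact incr_pair_joinxN (x : incr_pair) : x `|` incr_pair_neg x = \top.
Proof.
apply: val_inj; rewrite incr_pair_valU incr_pair_val1 joinEprod /= joinxC.
congr pair; apply/eqP; rewrite -le1x -[leLHS](joinxC (val x).1).
by apply: leU2 => //; exact: (valP x).
Qed.

Fact incr_pair_neg_min (x y : incr_pair) : x `|` y = \top -> incr_pair_neg x <= y.
Proof.
move=> xy; have: val (x `|` y) = \top by rewrite xy incr_pair_val1.
rewrite incr_pair_valU joinEprod => -[xy1 _].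
have le1 : ~` (val x).1 <= (val y).1.
  rewrite -[leLHS]meetx1 -xy1 meetUr meetCx join0x; exact: leIr.
by rewrite -Order.le_val leEprod /= le1 (le_trans le1 (valP y)).
Qed.

Fact incr_pair_neg_stone (x : incr_pair) :
  incr_pair_neg x `&` incr_pair_neg (incr_pair_neg x) = \bot.
Proof.
by apply: val_inj; rewrite incr_pair_valI incr_pair_val0 meetEprod /= meetxC.
Qed.

HB.instance Definition _ :=
  TBDistrLattice_isDualStone.Build (Order.prod_display d d) incr_pair
    incr_pair_joinxN incr_pair_neg_min incr_pair_neg_stone.

End IncrPair.

Arguments incr_pair {d} B.

Inductive formula : Type :=
| fVar of nat
| fTop
| fBot
| fOr of formula & formula
| fAnd of formula & formula
| fNeg of formula.

Reserved Notation "a |-DS b" (at level 70, no associativity).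

Inductive derives_DS : formula -> formula -> Prop :=
| ds_refl a : a |-DS a
| ds_trans a b c : a |-DS b -> b |-DS c -> a |-DS c
| ds_andl a b : fAnd a b |-DS a
| ds_andr a b : fAnd a b |-DS b
| ds_andI a b c : a |-DS b -> a |-DS c -> a |-DS fAnd b c
| ds_orl a b : a |-DS fOr a b
| ds_orr a b : b |-DS fOr a b
| ds_orE a b c : a |-DS c -> b |-DS c -> fOr a b |-DS c
| ds_distr a b c : fAnd a (fOr b c) |-DS fOr (fAnd a b) (fAnd a c)
| ds_top a : a |-DS fTop
| ds_bot a : fBot |-DS a
| ds_contra a b : a |-DS b -> fNeg b |-DS fNeg a
| ds_neg_and a b : fNeg (fAnd a b) |-DS fOr (fNeg a) (fNeg b)
| ds_neg_top : fNeg fTop |-DS fBot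
| ds_shift a b c : c |-DS fOr a b -> fNeg b |-DS fOr a (fNeg c)
| ds_em a : fTop |-DS fOr a (fNeg a)
| ds_stone a : fAnd (fNeg a) (fNeg (fNeg a)) |-DS fBot
where "a |-DS b" := (derives_DS a b).

Definition valuation d (D : dualStoneType d) (v : formula -> D) : Prop :=
  [/\ v fBot = \bot, v fTop = \top,
      {morph v : a b / fOr a b >-> a `|` b},
      {morph v : a b / fAnd a b >-> a `&` b}
    & {morph v : a / fNeg a >-> dneg a}].

Definition valid_in d (D : dualStoneType d) (a b : formula) : Prop :=
  forall v : formula -> D, valuation v -> v a <= v b.

(* Main.v *)
Require Import Defs.
From mathcomp Require Import all_boot all_order.
From mathcomp Require Import boolp classical_sets.

(** If [a] does not derive [b], Zorn's lemma gives a prime theory [P] containing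
    [a] but not [b].  The formulas whose negation is not in [P] again form a
    prime theory [M], contained in [P], and a negation lies in [P] iff it lies
    in [M].  Hence [f |-> (f \in M, f \in P)] is a valuation in the
    three-element chain, i.e. in [incr_pair (set unit)], refuting the
    consequent. *)

Set Implicit Arguments.
Unset Strict Implicit.
Unset Printing Implicit Defensive.

Import Order.Theory.
Local Open Scope order_scope.

Lemma dneg_anti d (D : dualStoneType d) (x y : D) : x <= y -> dneg y <= dneg x.
Proof.
move=> xy; apply: dneg_min; apply/eqP.
by rewrite -le1x -(joinx_dneg x); apply: leU2.
Qed.

Lemma derives_DS_sound a b : derives_DS a b ->
  forall d (D : dualStoneType d), valid_in D a b.
Proof.
move=> ab d D v [v0 v1 vU vI vN]; elim: ab => {a b}.
- by [].
- by move=> a b c _ ab _; apply: le_trans.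
- by move=> a b; rewrite vI leIl.
- by move=> a b; rewrite vI leIr.
- by move=> a b c _ ab _ ac; rewrite vI lexI ab.
- by move=> a b; rewrite vU leUl.
- by move=> a b; rewrite vU leUr.
- by move=> a b c _ ac _ bc; rewrite vU leUx ac.
- by move=> a b c; rewrite !(vI, vU) meetUr.
- by move=> a; rewrite v1 lex1.
- by move=> a; rewrite v0 le0x.
- by move=> a b _ ab; rewrite !vN dneg_anti.
- move=> a b; rewrite !(vN, vU, vI); apply: dneg_min.
  by rewrite joinIl joinA joinx_dneg join1x joinCA joinx_dneg joinx1 meetxx.
- by rewrite vN v1 v0; apply: dneg_min; rewrite joinx0.
(* By minimality of [dneg (v b)] it is enough that [v b], [v a] and [dneg (v c)] join to the top:
   already [v c] and [dneg (v c)] do, and [v c] is below the join of [v a] and [v b]. *)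
- move=> a b c _; rewrite !(vN, vU) => cab; apply: dneg_min; apply/eqP.
  rewrite -le1x -(joinx_dneg (v c)) joinA (joinC (v b)).
  exact: leU2.
- by move=> a; rewrite v1 vU vN joinx_dneg.
- by move=> a; rewrite vI !vN v0 dneg_stone.
Qed.

(** Pulled back to formulas, these are the prime filters of the Lindenbaum algebra. *)
Record prime_theory (P : formula -> Prop) : Prop := PrimeTheory {
  theory_mono : forall c e, derives_DS c e -> P c -> P e;
  theory_and : forall c e, P c -> P e -> P (fAnd c e);
  theory_top : P fTop;
  theory_bot : ~ P fBot;
  theory_or : forall c e, P (fOr c e) -> P c \/ P e
}.

Lemma ds_and_mono a b c e : derives_DS a b -> derives_DS c e ->
  derives_DS (fAnd a c) (fAnd b e).
Proof.
by move=> ab ce; apply: ds_andI;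
  [apply: ds_trans (ds_andl _ _) ab | apply: ds_trans (ds_andr _ _) ce].
Qed.

(** Distributivity at work; it makes a maximal theory omitting [b] prime, with [s] and [t] as the
    members that yield [b] together with [c] and [e]. *)
Lemma ds_and_or s t c e b :
  derives_DS (fAnd s c) b -> derives_DS (fAnd t e) b ->
  derives_DS (fAnd (fAnd s t) (fOr c e)) b.
Proof.
move=> sc te; apply: ds_trans (ds_distr _ _ _) _.
apply: ds_orE; [apply: ds_trans sc | apply: ds_trans te].
- exact: ds_and_mono (ds_andl _ _) (ds_refl _).
- exact: ds_and_mono (ds_andr _ _) (ds_refl _).
Qed.

Lemma prime_theory_exists a b : ~ derives_DS a b ->
  exists P, [/\ prime_theory P, P a & ~ P b].
Proof.
move=> nab.
(* Requiring only that nonempty sets contain [a] admits the union of the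
   empty chain. *)
pose good (S : set formula) := [/\ forall c e, derives_DS c e -> S c -> S e,
  forall c e, S c -> S e -> S (fAnd c e), forall c, S c -> S a & ~ S b].
have [|P [[Pmono Pand Pa0 Pb] Pmax]] := @Zorn_bigcup _ good.
  move=> F Fgood Ftot; split.
  - move=> c e ce [X FX Xc]; exists X => //.
    by have [mono _ _ _] := Fgood _ FX; apply: mono Xc.
  - move=> c e [X FX Xc] [Y FY Ye].
    have [XY|YX] := Ftot _ _ FX FY.
      exists Y => //; have [_ meet _ _] := Fgood _ FY.
      by apply: meet => //; apply: XY.
    exists X => //; have [_ meet _ _] := Fgood _ FX.
    by apply: meet => //; apply: YX.
  - move=> c [X FX Xc]; exists X => //.
    by have [_ _ Xa _] := Fgood _ FX; apply: Xa Xc.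
  - by move=> [X FX]; have [_ _ _] := Fgood _ FX.
have Pa : P a.
  (* Without [a] the set [P] would be empty, and the consequences of [a] would properly extend
     it. *)
  apply: contrapT => nPa; apply: (Pmax (derives_DS a)).
    split; first by move=> c /Pa0 /nPa.
    by move=> sub; apply: nPa; apply: sub; apply: ds_refl.
  split=> //.
  - by move=> c e ce ac; apply: ds_trans ce.
  - by move=> c e; apply: ds_andI.
  - by move=> c _; apply: ds_refl.
(* Otherwise the theory generated by [P] and [c] would omit [b], against maximality. *)
have ext c : ~ P c -> exists2 s, P s & derives_DS (fAnd s c) b.
  move=> nPc; apply: contrapT => nb.
  apply: (Pmax (fun e => exists2 s, P s & derives_DS (fAnd s c) e)).
    split; first by move=> e Pe; exists e => //; apply: ds_andl.
    by move=> sub; apply: nPc; apply: sub; exists a => //; apply: ds_andr.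
  split=> //.
  - by move=> e f ef [s Ps se]; exists s => //; apply: ds_trans ef.
  - move=> e f [s Ps se] [t Pt tf]; exists (fAnd s t); first exact: Pand.
    apply: ds_andI; [apply: ds_trans se | apply: ds_trans tf].
    + exact: ds_and_mono (ds_andl _ _) (ds_refl _).
    + exact: ds_and_mono (ds_andr _ _) (ds_refl _).
  - by move=> _ _; exists a => //; apply: ds_andl.
exists P; split=> //; split=> //.
- exact: Pmono (ds_top a) Pa.
- by move=> /(Pmono _ _ (ds_bot b)).
- move=> c e Pce; have [|nPc] := pselect (P c); first by left.
  right; apply: contrapT => nPe.
  have [s Ps sc] := ext _ nPc; have [t Pt te] := ext _ nPe.
  by apply/Pb/(Pmono _ _ (ds_and_or sc te))/Pand => //; apply: Pand.
Qed.

(** Minimality of the dual pseudocomplement, from [ds_shift] at [fTop], whose negation collapses to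
    [fBot]. *)
Lemma ds_neg_le_of_join a b : derives_DS fTop (fOr a b) ->
  derives_DS (fNeg b) a.
Proof.
move=> /ds_shift h; apply: ds_trans h _; apply: ds_orE; first exact: ds_refl.
exact: ds_trans ds_neg_top (ds_bot _).
Qed.

Lemma ds_or_assoc a b c : derives_DS (fOr a (fOr b c)) (fOr (fOr a b) c).
Proof.
apply: ds_orE; first exact: ds_trans (ds_orl _ _) (ds_orl _ _).
apply: ds_orE; last exact: ds_orr.
exact: ds_trans (ds_orr _ _) (ds_orl _ _).
Qed.

Lemma ds_or_comm a b : derives_DS (fOr a b) (fOr b a).
Proof. by apply: ds_orE; [apply: ds_orr | apply: ds_orl]. Qed.

Lemma ds_or_mono a b c e : derives_DS a b -> derives_DS c e ->
  derives_DS (fOr a c) (fOr b e).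
Proof.
by move=> ab ce; apply: ds_orE;
  [apply: ds_trans ab (ds_orl _ _) | apply: ds_trans ce (ds_orr _ _)].
Qed.

(** Minimality is applied twice: to the join of [x], [b] and [a], which bounds [fNeg a] by
    [fOr x b], and then to excluded middle for [fNeg a] weakened by that bound. *)
Lemma ds_neg_or_stone a b :
  derives_DS (fNeg b) (fOr (fNeg (fNeg a)) (fNeg (fOr a b))).
Proof.
set x := fNeg (fOr a b).
have na : derives_DS (fNeg a) (fOr x b).
  apply: ds_neg_le_of_join; apply: ds_trans (ds_em (fOr a b)) _.
  apply: ds_trans (ds_or_comm _ _) _.
  apply: ds_trans (ds_or_mono (ds_refl x) (ds_or_comm a b)) _.
  exact: ds_or_assoc.
apply: ds_neg_le_of_join; apply: ds_trans (ds_em (fNeg a)) _.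
apply: ds_trans (ds_or_comm _ _) _.
exact: ds_trans (ds_or_mono (ds_refl _) na) (ds_or_assoc _ _ _).
Qed.

Section Canonical.
Variables (P : formula -> Prop) (PP : prime_theory P).

Lemma theory_orE c e : P (fOr c e) <-> P c \/ P e.
Proof.
split; first exact: theory_or.
by case; [apply: (theory_mono PP (ds_orl _ _)) | apply: (theory_mono PP (ds_orr _ _))].
Qed.

Lemma theory_andE c e : P (fAnd c e) <-> P c /\ P e.
Proof.
split; last by case; apply: theory_and.
by move=> h; split; [apply: (theory_mono PP (ds_andl _ _) h)
                    | apply: (theory_mono PP (ds_andr _ _) h)].
Qed.

Lemma theory_em c : P c \/ P (fNeg c).
Proof. exact/(theory_or PP)/(theory_mono PP (ds_em c))/(theory_top PP). Qed.

(** The Stone law forbids both formulas in [P], and excluded middle forces one of them. *)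
Lemma theory_neg_negE c : P (fNeg (fNeg c)) <-> ~ P (fNeg c).
Proof.
split=> [h h'|]; last by have [] := theory_em (fNeg c).
exact/(theory_bot PP)/(theory_mono PP (ds_stone c))/(theory_and PP).
Qed.

Lemma theory_neg_andE c e : P (fNeg (fAnd c e)) <-> P (fNeg c) \/ P (fNeg e).
Proof.
split; first by move=> /(theory_mono PP (ds_neg_and _ _)) /theory_orE.
by case; apply: (theory_mono PP); apply: ds_contra; [apply: ds_andl | apply: ds_andr].
Qed.

Lemma theory_neg_orE c e : P (fNeg (fOr c e)) <-> P (fNeg c) /\ P (fNeg e).
Proof.
split=> [h|[nc /(theory_mono PP (ds_neg_or_stone c e))]].
  by split; apply: (theory_mono PP _ h); apply: ds_contra; [apply: ds_orl | apply: ds_orr].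
by move=> /theory_orE [/theory_neg_negE|].
Qed.

(** Subsets of [unit] act as truth values: each component is a constant predicate, hence empty or
    full. *)
Definition canonical_pair (f : formula) : set unit *p set unit :=
  ((fun _ => ~ P (fNeg f)) : set unit, (fun _ => P f) : set unit).

Lemma canonical_pair_incr f : incr_pair_pred (canonical_pair f).
Proof.
by rewrite /incr_pair_pred; apply/subsetPset => _ /= h; have [] := theory_em f.
Qed.

Definition canonical_valuation (f : formula) : incr_pair (set unit) :=
  IncrPair (canonical_pair_incr f).

Lemma canonical_valuationP : valuation canonical_valuation.
Proof.
split=> [||c e|c e|c]; apply: val_inj.
- rewrite incr_pair_val0; congr pair; apply/funext => u; apply/propext.
    split=> // h; apply: h.
    apply: (theory_mono PP _ (theory_top PP)).
    (* Excluded middle for [fBot] puts [fNeg fBot] in every theory. *)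
    apply: ds_trans (ds_em fBot) _; apply: ds_orE; first exact: ds_bot.
    exact: ds_refl.
  by split=> // /(theory_bot PP).
- rewrite incr_pair_val1; congr pair; apply/funext => u; apply/propext.
    split=> // _ /(theory_mono PP ds_neg_top); exact: (theory_bot PP).
  by split=> // _; apply: (theory_top PP).
- rewrite incr_pair_valU; congr pair; apply/funext => u; apply/propext.
    by rewrite theory_neg_orE not_andP.
  exact: theory_orE.
- rewrite incr_pair_valI; congr pair; apply/funext => u; apply/propext.
    by rewrite theory_neg_andE not_orP.
  exact: theory_andE.
- congr pair; apply/funext => u; apply/propext.
    (* Both components of a negated pair are the complement of its first component, here
       [~ P (fNeg c)]. *)
    change (~ P (fNeg (fNeg c)) <-> ~ ~ P (fNeg c)).
    by rewrite theory_neg_negE.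
  change (P (fNeg c) <-> ~ ~ P (fNeg c)).
  by rewrite not_notE.
Qed.

End Canonical.

Lemma derives_DS_complete a b : valid_in (incr_pair (set unit)) a b ->
  derives_DS a b.
Proof.
move=> ab; apply: contrapT => /prime_theory_exists [P [PP Pa nPb]].
have := ab _ (canonical_valuationP PP).
(* The second components, read at the point [tt], carry [P a] to [P b]. *)
rewrite -Order.le_val leEprod => /andP [_ /subsetPset /(_ tt Pa)].
exact: nPb.
Qed.

Theorem theorem7 (a b : formula) :
  [<-> derives_DS a b;
       (forall (d : Order.disp_t) (D : dualStoneType d), valid_in D a b);
       (forall (d : Order.disp_t) (B : ctbDistrLatticeType d),
          valid_in (incr_pair B) a b);
       (forall U : Type, valid_in (incr_pair (set U)) a b)].
Proof.
tfae.
- exact: derives_DS_sound.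
- by move=> h d B; apply: h.
- by move=> h U; apply: h.
- by move=> h; apply: derives_DS_complete; apply: h.
Qed.
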